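(* Let $G$ be a finitely generated group, $(X,d)$ a compact metric space and $\varphi:G\times X\to X$ a continuous action. Then: (1) $\displaystyle \mathcal{M}_{PSh}(X,\varphi)=\bigcap_{n\in\mathbb{N}}\Big(\bigcup_{m\in\mathbb{N}}\Big(\bigcap_{l\in\mathbb{N}}\mathcal{C}_{PSh(\varphi)}(m^{-1},\,n^{-1}+l^{-1})\Big)\Big)$; (2) $\mathcal{M}_{PSh}(X,\varphi)$ is an $F_{\sigma\delta}$ subset of $\mathcal{M}(X)$.
   Context: Fix a finite generating set $S$ of $G$ (discrete topology). For continuous actions $\varphi,\psi$ of $G$ on $X$ put $d_S(\varphi,\psi)=\sup\{d(\varphi(s,x),\psi(s,x)): x\in X, s\in S\}$. A map $f:G\to X$ is a $\delta$-pseudo orbit for $\psi$ if $d(f(sg),\psi(s,f(g)))<\delta$ for all $s\in S$, $g\in G$; it is $(\psi,\epsilon)$-shadowed by $p\in X$ if $d(f(g),\psi(g,p))<\epsilon$ for all $g\in G$. $Sh_\psi(\delta,\epsilon)$ is the set of $x\in X$ such that every $\delta$-pseudo orbit $f$ for $\psi$ with $f(e)=x$ is $(\psi,\epsilon)$-shadowed by a point of $X$. $PSh_\varphi(\delta,\epsilon)$ is the set of $x\in X$ such that for every continuous action $\psi:G\times X\to X$ with $d_S(\varphi,\psi)<\delta$, every $\delta$-pseudo orbit $f:G\to X$ for $\psi$ with $f(e)=x$ is $(\psi,\epsilon)$-shadowed by a point of $X$. $\mathcal{M}(X)$ is the set of Borel probability measures on $X$ with the weak$^*$ topology. $\mu\in\mathcal{M}(X)$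 is compatible with the persistent shadowing property for $\varphi$, written $\mu\in\mathcal{M}_{PSh}(X,\varphi)$, if for every $\epsilon>0$ there is $\delta>0$ such that for every Borel set $A\subseteq X$ with $\mu(A)>0$ one has $A\cap Sh_\psi(\delta,\epsilon)\neq\emptyset$ for every continuous action $\psi:G\times X\to X$ with $d_S(\varphi,\psi)<\delta$. Put $\mathcal{C}_{PSh(\varphi)}(\delta,\epsilon)=\{\mu\in\mathcal{M}(X):\mu(PSh_\varphi(\delta,\epsilon))=1\}$. $\mathbb{N}=\{1,2,\dots\}$. An $F_{\sigma\delta}$ set is a countable intersection of countable unions of closed sets. *)

(* Defs.v *)
From HB Require Import structures.
From mathcomp Require Import all_boot all_order all_algebra.
From mathcomp Require Import all_classical all_reals all_analysis.
From mathcomp Require Import borel_hierarchy.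

Set Implicit Arguments.
Unset Strict Implicit.
Unset Printing Implicit Defensive.

Import Order.TTheory GRing.Theory Num.Theory.
Import numFieldNormedType.Exports.

Local Open Scope classical_set_scope.
Local Open Scope ring_scope.

(* MathComp-Analysis measurable types are pointed, so metric spaces carrying
   Borel measures are required to be nonempty. *)
#[short(type="pmetricType")]
HB.structure Definition PointedMetric (K : numDomainType) :=
  {M of Metric K M & Pointed M}.

(* S need not be symmetric: H ranges over subgroups. *)
Definition generates (G : groupType) (S : set G) : Prop :=
  forall H : {pred G}, group_closed H -> (forall s, S s -> s \in H) ->
  forall g, g \in H.

Section actions.
Context (R : realType) (G : groupType) (X : metricType R).
Implicit Types (S : set G) (phi psi : G -> X -> X) (delta eps : R).

Definition continuous_action phi : Prop :=
  [/\ forall x, phi 1%g x = x,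
      forall g h x, phi (g * h)%g x = phi g (phi h x)
    & continuous (fun gx : discrete_topology G * X => phi gx.1 gx.2)].

(* The supremum is over a bounded set when X is compact; if S is empty, it is
   sup set0 = 0. *)
Definition dist_action S phi psi : R :=
  sup [set mdist (phi s x) (psi s x) | s in S & x in [set: X]].

Definition pseudo_orbit S psi delta (f : G -> X) : Prop :=
  forall s g, S s -> mdist (f (s * g)%g) (psi s (f g)) < delta.

Definition shadowed psi eps (f : G -> X) (p : X) : Prop :=
  forall g, mdist (f g) (psi g p) < eps.

Definition Sh S psi delta eps : set X :=
  [set x | forall f, pseudo_orbit S psi delta f -> f 1%g = x ->
           exists p, shadowed psi eps f p].

Definition PSh S phi delta eps : set X :=
  [set x | forall psi, continuous_action psi -> dist_action S phi psi < delta ->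
           forall f, pseudo_orbit S psi delta f -> f 1%g = x ->
           exists p, shadowed psi eps f p].

End actions.

Notation borel X := (g_sigma_algebraType (@open X)).

Definition borel_probability (R : realType) (X : pmetricType R) :=
  probability (borel X) R.

Definition integrals (R : realType) (X : pmetricType R)
    (mu : borel_probability X) : {ptws continuousType X R -> R} :=
  fun f => (\int[mu]_x f x)%R.

(* The weak* topology: the coarsest one making mu |-> \int f dmu continuous
   for every continuous f : X -> R. *)
#[warnings="-redundant-canonical-projection"]
HB.instance Definition _ (R : realType) (X : pmetricType R) :=
  Topological.copy (borel_probability X) (initial_topology (@integrals R X)).

(* "mu A = 1" for a set A that need not be Borel: A has measure 1 for the
   completion of mu. *)
Definition full_measure d (T : measurableType d) (R : realType)
    (mu : probability T R) (A : set T) : Prop :=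
  exists B, [/\ measurable B, B `<=` A & mu B = 1%E].

Lemma full_measureE d (T : measurableType d) (R : realType)
    (mu : probability T R) (A : set T) :
  measurable A -> full_measure mu A <-> mu A = 1%E.
Proof.
move=> mA; split=> [[B [mB BA muB]]|muA]; last by exists A; split.
apply/eqP; rewrite eq_le probability_le1//= -muB.
by apply: le_measure; rewrite ?inE.
Qed.

Section persistent_shadowing_measures.
Context (R : realType) (G : groupType) (X : pmetricType R).
Implicit Types (S : set G) (phi psi : G -> X -> X) (delta eps : R).

Definition M_PSh S phi : set (borel_probability X) :=
  [set mu | forall eps, 0 < eps -> exists2 delta, 0 < delta &
    forall A : set (borel X), measurable A -> (0 < mu A)%E ->
    forall psi, continuous_action psi -> dist_action S phi psi < delta ->
    A `&` Sh S psi delta eps !=set0].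

Definition C_PSh S phi delta eps : set (borel_probability X) :=
  [set mu | full_measure mu (PSh S phi delta eps : set (borel X))].

End persistent_shadowing_measures.

Definition Fsigmadelta (T : topologicalType) (A : set T) : Prop :=
  exists2 F : (set T)^nat, (forall i, Fsigma (F i)) & A = \bigcap_i F i.

Definition posnat : set nat := [set n | (0 < n)%N].

(* Main.v *)
Require Import Defs.
From mathcomp Require Import all_boot all_order all_algebra.
From mathcomp Require Import all_classical all_reals all_analysis.
From HB Require Import structures.
From mathcomp Require Import measurable_realfun lra.

(** Up to an arbitrarily small loss in the parameters, [PSh S phi delta eps] can
    be replaced by a closed set: [closed_PSh S phi delta eps], the intersection,
    over all actions psi that are delta-close to phi, of the closures of
    [Sh S psi delta eps]. Both parts of the theorem come from
    comparing three properties of a measure mu.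

    (a) Every Borel set of positive measure meets each [Sh S psi delta eps]
    ([meets_Sh]; this is what compatibility asks for, once eps and delta are
    chosen).
    (b) mu gives measure 1 to [closed_PSh S phi delta eps].
    (c) [PSh S phi delta eps] has full measure.

    (a) implies (b) with the same parameters: the complement of the closure of
    one [Sh S psi delta eps] misses that set, hence is an open null set, and in
    a compact metric space a union of open null sets, however many, is null
    ([bigcup_open_null]).

    (b) implies (c) after an arbitrarily small decrease of delta and increase
    of eps. If x is a limit of points y at which psi is shadowing, redirect a
    pseudo orbit f through x so that its value at the identity becomes a
    nearby y. This perturbs each inequality defining pseudo orbits by an
    arbitrarily small amount, since only the finitely many continuous maps
    psi s with s in S are involved; a point that shadows the redirected orbit
    also shadows f, up to the distance from x to y ([closure_Sh]). How close y
    must be to x depends on psi, but the loss in delta and eps does not, which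
    is why the intersection over psi causes no harm.

    (c) implies (a) with the same parameters, because a set of positive measure
    meets every set of full measure.

    Going around the circle gives (1); the term 1/l on its right-hand side is
    the increase of eps in (b) => (c). It also gives [M_PShE], the same formula
    with (b) in place of the intersection over l. Now having measure 1 on a
    fixed closed set K is a closed condition on mu for the weak* topology
    ([closed_measure1]), since it says that a bounded continuous function
    vanishing exactly on K has integral 0; this gives (2). *)

Set Implicit Arguments.
Unset Strict Implicit.
Unset Printing Implicit Defensive.

Import Order.TTheory GRing.Theory Num.Theory.
Import numFieldNormedType.Exports.

Local Open Scope classical_set_scope.
Local Open Scope ring_scope.

(** * Distance to a set *)

(** The metric of the extended reals is the one pulled back from the reals
    along [contract], so that [contract] is an isometry. *)
Lemma contract_continuous (R : realType) : continuous (@contract R).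
Proof.
move=> x; apply/cvgrPdist_lt => e e0.
by near=> y; near: y; exact: (@nbhsx_ballx R (\bar R) x e e0).
Unshelve. all: by end_near. Qed.

Lemma edist_inf_closure (R : realType) (X : pseudoMetricType R) (K : set X) x :
  edist_inf K x = 0%E -> closure K x.
Proof.
move=> Kx0 U /nbhs_ballP[e /= e0 eU].
have /ereal_inf_lt[_ [a Ka <-] /edist_lt_ball/eU Ua] : (edist_inf K x < e%:E)%E.
  by rewrite Kx0 lte_fin.
by exists a.
Qed.

(** * Borel probability measures on a metric space *)

Lemma probability1_setC d (T : measurableType d) (R : realType)
    (mu : probability T R) (A : set T) :
  measurable A -> mu A = 1%E <-> mu (~` A) = 0%E.
Proof.
move=> mA; rewrite probability_setC//; split=> [->|/eqP]; first by rewrite subee.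
by rewrite sube_eq ?fin_num_adde_defl ?fin_num_measure// add0e => /eqP <-.
Qed.

Section borel_measures.
Context (R : realType) (X : pmetricType R).

Lemma open_borel (U : set X) : open U -> measurable (U : set (borel X)).
Proof. exact: sub_sigma_algebra. Qed.

Lemma closed_borel (K : set X) : closed K -> measurable (K : set (borel X)).
Proof.
move=> cK; rewrite -(setCK K).
by apply: measurableC; exact: open_borel (closed_openC cK).
Qed.

Lemma continuous_borel_measurable (f : X -> R) :
  continuous f -> measurable_fun [set: borel X] (f : borel X -> R).
Proof.
move=> /continuousP cf.
apply: (measurability _ (RGenOpens.measurableE R)).
move=> _ [_ [a [b ->] <-]]; rewrite setTI; apply: open_borel; apply: cf.
exact: interval_open.
Qed.

(** The index set D may be uncountable: the union is also the union of those
    members of a countable basis that lie inside some U i, and these are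
    countably many null sets. *)
Lemma bigcup_open_null (mu : {measure set (borel X) -> \bar R})
    (I : Type) (D : set I) (U : I -> set X) :
  @second_countable X -> (forall i, D i -> open (U i)) ->
  (forall i, D i -> mu (U i) = 0%E) -> mu (\bigcup_(i in D) U i) = 0%E.
Proof.
move=> [B cB [oB baseB]] oU U0.
have oDU : open (\bigcup_(i in D) U i) by exact: bigcup_open.
pose N := [set V | B V /\ exists2 i, D i & V `<=` U i].
have N0 V : N V -> mu.-negligible (V : set (borel X)).
  move=> [_ [i Di VU]]; apply: (@negligibleS _ _ _ mu (U i) V VU).
  by apply/negligibleP; [exact: open_borel (oU _ Di)|exact: U0].
have cN : countable N by apply: sub_countable cB; apply: subset_card_le => ? [].
apply: measure_negligible; first exact: open_borel.
apply: (@negligibleS _ _ _ mu (\bigcup_(V in N) V)).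
  move=> x [i Di Uix].
  have /baseB[V [BV Vx] VU] := open_nbhs_nbhs (conj (oU _ Di) Uix).
  by exists V => //; split => //; exists i.
have [->|[g]] := pfcard_geP cN.
  by rewrite bigcup_set0; exact: negligible_set0.
rewrite -(image_eq g) bigcup_image.
by apply: negligible_bigcup => k; apply: N0; exact: funS.
Qed.

Lemma bigcap_closed_measure1 (mu : borel_probability X)
    (I : Type) (D : set I) (K : I -> set X) :
  compact [set: X] -> (forall i, D i -> closed (K i)) ->
  (forall i, D i -> mu (K i) = 1%E) -> mu (\bigcap_(i in D) K i) = 1%E.
Proof.
move=> cX cK K1.
apply/probability1_setC; first by apply: closed_borel; exact: closed_bigI.
rewrite setC_bigcap; apply: bigcup_open_null.
- exact: compact_second_countable.
- by move=> i /cK/closed_openC.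
- move=> i Di; apply/probability1_setC; last exact: K1.
  exact: closed_borel (cK _ Di).
Qed.

Lemma integrals_continuous (f : continuousType X R) :
  continuous (fun mu : borel_probability X => (\int[mu]_x f x)%R).
Proof.
move=> mu; apply: (@continuous_comp _ _ _ (@integrals R X) (fun F => F f)).
  exact: initial_continuous.
exact: (@proj_continuous _ (fun=> R) f).
Qed.

(** The set in question is the zero set of the continuous map sending mu to
    the integral of f0, where f0 >= 0 is continuous and vanishes exactly
    on K. *)
Lemma closed_measure1 (K : set X) : closed K ->
  closed [set mu : borel_probability X | mu K = 1%E].
Proof.
move=> cK.
(* contracting the distance to K makes it real valued and bounded, also when K
   is empty and the distance is +oo everywhere *)
pose f0 : X -> R := @contract R \o edist_inf K.
have cf0 : continuous f0.
  by move=> x; apply: continuous_comp;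
    [exact: edist_inf_continuous|exact: contract_continuous].
pose f1 := isContinuous.Build X R f0 cf0.
pose f : continuousType X R := HB.pack f0 f1.
have f0_ge0 x : 0 <= f0 x by rewrite -contract0 le_contract edist_inf_ge0.
have mf : measurable_fun [set: borel X] (f0 : borel X -> R).
  exact: continuous_borel_measurable.
have f0K : [set x | f0 x = 0] = K.
  apply/seteqP; split=> x /=.
    move=> /eqP; rewrite contract_eq0 => /eqP/edist_inf_closure.
    by rewrite -(closure_id K).1.
  by rewrite /f0/= => /edist_inf0 ->; exact: contract0.
rewrite (_ : mkset _ =
    (fun mu : borel_probability X => (\int[mu]_x f x)%R) @^-1` [set 0]).
  apply: preimage_closed => [mu _|]; first exact: integrals_continuous.
  exact: closed_eq.
apply/funext => mu; apply/propext => /=.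
have intf : mu.-integrable [set: borel X] (EFin \o f0).
  apply: measurable_bounded_integrable => //.
    by rewrite -ge0_fin_numE// fin_num_measure.
  exists 1; split => // M M1 x _ /=; rewrite (le_trans _ (ltW M1))//.
  exact: contract_le1.
pose g : borel X -> \bar R := EFin \o f0.
have absE : (\int[mu]_x `|g x| = \int[mu]_x g x)%E.
  by apply: eq_integral => x _; rewrite gee0_abs//= lee_fin.
apply: (iff_trans (probability1_setC mu (closed_borel cK))).
have mg : @measurable_fun _ _ (borel X) (\bar R) setT g.
  exact/measurable_EFinP.
have := ae_eq_integral_abs mu measurableT mg; rewrite absE => int0.
have -> : mu (~` K) = 0%E <-> ae_eq mu setT g (cst 0%E).
  apply: (iff_trans (iff_sym (negligibleP mu (measurableC (closed_borel cK))))).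
  rewrite (_ : K = [set x | setT x -> g x = cst 0%E x])//.
  rewrite -[LHS]f0K.
  by apply/seteqP; split=> x /= => [fx0 _|/(_ I) []]//; congr EFin.
rewrite -int0; split; rewrite /Rintegral; first by move=> ->.
move=> /eqP; rewrite fine_eq0; last exact: integrable_fin_num.
by move/eqP.
Qed.

End borel_measures.

(** * Shadowable points *)

Section shadowing.
Context (R : realType) (G : groupType) (X : metricType R).
Implicit Types (S : set G) (phi psi : G -> X -> X) (d e : R).

Lemma Sh_subset S psi d d' e e' : d <= d' -> e <= e' ->
  Sh S psi d' e `<=` Sh S psi d e'.
Proof.
move=> dd' ee' x Shx f fpo fx.
have [|p fp] := Shx f _ fx; first by move=> s g /fpo /lt_le_trans; exact.
by exists p => g; exact: lt_le_trans (fp g) ee'.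
Qed.

Lemma continuous_action_fiber psi s : continuous_action psi ->
  continuous (psi s).
Proof.
move=> [_ _ cpsi] x.
apply: (@continuous_comp _ _ _ (fun y => (s : discrete_topology G, y))
  (fun gx => psi gx.1 gx.2)); last exact: cpsi.
exact: (@cvg_pair _ _ _ (nbhs x) _ _ _ _ _ (fun=> _) id
  (cvg_cst _) (@cvg_id _ _)).
Qed.

(** A pseudo orbit f through x is turned into a pseudo orbit f' through a
    shadowable point y near x by changing its value at the identity only. With
    y within eta of x, and psi s y within eta of psi s x for s in S, the pseudo
    orbit inequality at (s, g) changes by at most 2 eta: one eta in case
    s * g = 1, the other in case g = 1. *)
Lemma closure_Sh S psi d d' e e' : finite_set S -> continuous_action psi ->
  d < d' -> e < e' -> closure (Sh S psi d' e) `<=` Sh S psi d e'.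
Proof.
move=> finS actpsi dd' ee' x clx f fpo fx.
pose eta := Num.min ((d' - d) / 2) (e' - e).
have eta0 : 0 < eta by rewrite lt_min divr_gt0 ?subr_gt0.
pose N := ball x eta `&` \bigcap_(s in S) psi s @^-1` ball (psi s x) eta.
have nbhsN : nbhs x N.
  apply: filterI; first exact: nbhsx_ballx.
  have : forall s, S s -> nbhs x (psi s @^-1` ball (psi s x) eta).
    by move=> s _; apply: continuous_action_fiber => //; exact: nbhsx_ballx.
  move: finS => /finite_fsetP[S' ->] nbhsS.
  exact: filter_bigI.
have [y [Shy [xy psixy]]] := clx _ nbhsN.
pose f' g := if g == 1%g then y else f g.
have ff' g : mdist (f g) (f' g) < eta.
  rewrite /f'; case: eqP => [->|_]; last by rewrite mdistxx.
  by rewrite fx; move: xy; rewrite ballEmdist.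
have psiff' s g : S s -> mdist (psi s (f g)) (psi s (f' g)) < eta.
  move=> Ss; rewrite /f'; case: eqP => [->|_]; last by rewrite mdistxx.
  by rewrite fx; have := psixy s Ss; rewrite /= ballEmdist.
have [||p f'p] := Shy f'.
- move=> s g Ss.
  have eta_le : eta <= (d' - d) / 2 by rewrite ge_min lexx.
  have := metric_triangle (f' (s * g)%g) (f (s * g)%g) (psi s (f' g)).
  have := metric_triangle (f (s * g)%g) (psi s (f g)) (psi s (f' g)).
  rewrite (metric_sym (f' _) (f _)).
  have := ff' (s * g)%g; have := psiff' s g Ss; have := fpo s g Ss.
  lra.
- by rewrite /f' eqxx.
- exists p => g; have := metric_triangle (f g) (f' g) (psi g p).
  have eta_le : eta <= e' - e by rewrite ge_min lexx orbT.
  have := ff' g; have := f'p g; lra.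
Qed.

(** Closing up each [Sh S psi delta eps] before intersecting over psi matters:
    the intersection of the closures contains the closure of
    [PSh S phi delta eps] and can be larger, and a set of positive measure is
    only known to meet the sets [Sh S psi delta eps] one at a time. *)
Definition closed_PSh S phi delta eps : set X :=
  \bigcap_(psi in
      [set psi | continuous_action psi /\ dist_action S phi psi < delta])
    closure (Sh S psi delta eps).

Lemma closed_closed_PSh S phi d e : closed (closed_PSh S phi d e).
Proof. by apply: closed_bigI => psi _; exact: closed_closure. Qed.

Lemma closed_PSh_PSh S phi d d' e e' : finite_set S -> d < d' -> e < e' ->
  closed_PSh S phi d' e `<=` PSh S phi d e'.
Proof.
move=> finS dd' ee' x clx psi actpsi dpsi.
apply: (closure_Sh finS actpsi dd' ee'); apply: clx; split => //.
exact: lt_trans dd'.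
Qed.

End shadowing.

(** * Measures compatible with persistent shadowing *)

Section compatible_measures.
Context (R : realType) (G : groupType) (X : pmetricType R).
Implicit Types (S : set G) (phi psi : G -> X -> X) (d e : R)
  (mu : borel_probability X).

Definition meets_Sh S phi d e mu : Prop :=
  forall A : set (borel X), measurable A -> (0 < mu A)%E ->
  forall psi, continuous_action psi -> dist_action S phi psi < d ->
  A `&` Sh S psi d e !=set0.

Lemma meets_Sh_le S phi d d' e e' mu : d <= d' -> e <= e' ->
  meets_Sh S phi d' e mu -> meets_Sh S phi d e' mu.
Proof.
move=> dd' ee' meet A mA A0 psi actpsi dpsi.
have [x [Ax Shx]] := meet A mA A0 psi actpsi (lt_le_trans dpsi dd').
by exists x; split => //; exact: Sh_subset dd' ee' _ Shx.
Qed.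

Lemma meets_Sh_closed_PSh S phi d e mu : compact [set: X] ->
  meets_Sh S phi d e mu -> mu (closed_PSh S phi d e) = 1%E.
Proof.
move=> cX meet; apply: bigcap_closed_measure1 => // psi [actpsi dpsi].
  exact: closed_closure.
have mC : measurable (~` closure (Sh S psi d e) : set (borel X)).
  exact: open_borel (closed_openC (@closed_closure _ _)).
apply/probability1_setC; first exact: closed_borel (@closed_closure _ _).
apply/eqP; rewrite -measure_le0 leNgt; apply/negP => C0.
have [x [Cx Shx]] := meet _ mC C0 psi actpsi dpsi.
exact/Cx/subset_closure.
Qed.

Lemma closed_PSh_C_PSh S phi d d' e e' mu : finite_set S -> d < d' -> e < e' ->
  mu (closed_PSh S phi d' e) = 1%E -> C_PSh S phi d e' mu.
Proof.
move=> finS dd' ee' mu1; exists (closed_PSh S phi d' e); split => //.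
  exact: closed_borel (@closed_closed_PSh _ _ _ _ _ _ _).
exact: closed_PSh_PSh.
Qed.

Lemma C_PSh_meets_Sh S phi d e mu : C_PSh S phi d e mu -> meets_Sh S phi d e mu.
Proof.
move=> [B [mB BPSh mu1]] A mA A0 psi actpsi dpsi.
have [x [Ax Bx]] : A `&` B !=set0.
  apply/set0P/eqP => AB0.
  have : (mu A <= mu (~` B))%E.
    rewrite le_measure ?inE//; first exact: measurableC.
    exact/disjoints_subset.
  by move/probability1_setC : mu1 => ->//; rewrite leNgt A0.
by exists x; split => // f; exact: BPSh.
Qed.

(** Compatibility is a countable combination of closed conditions on mu. *)
Lemma M_PShE S phi : finite_set S -> compact [set: X] ->
  M_PSh S phi = \bigcap_n \bigcup_m
    [set mu | mu (closed_PSh S phi m.+1%:R^-1 n.+1%:R^-1) = 1%E].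
Proof.
move=> finS cX; apply/seteqP; split=> mu.
  move=> Mmu n _; have [|d d0 meet] := Mmu n.+1%:R^-1; first by rewrite invr_gt0.
  have [m] := ltr_add_invr d0; rewrite add0r => md; exists m => //.
  by apply: meets_Sh_closed_PSh => //; exact: meets_Sh_le (ltW md) (lexx _) meet.
move=> + e e0 => Mmu; have [n] := ltr_add_invr e0; rewrite add0r => ne.
have [m _ /= mu1] := Mmu n I; exists m.+2%:R^-1; first by rewrite invr_gt0.
apply/C_PSh_meets_Sh/(closed_PSh_C_PSh finS _ ne mu1).
by rewrite ltf_pV2 ?posrE// ltr_nat.
Qed.

End compatible_measures.

Theorem proposition2p10 (R : realType) (G : groupType) (S : set G)
    (X : pmetricType R) (phi : G -> X -> X)
    (finS : finite_set S) (genS : generates S)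
    (compactX : compact [set: X]) (actphi : continuous_action phi) :
  M_PSh S phi =
    \bigcap_(n in posnat) \bigcup_(m in posnat) \bigcap_(l in posnat)
      C_PSh S phi m%:R^-1 (n%:R^-1 + l%:R^-1)
  /\ Fsigmadelta (M_PSh S phi).
Proof.
have ME := M_PShE phi finS compactX.
split; last first.
  rewrite ME; eexists; last reflexivity; move=> n.
  eexists; last reflexivity; move=> m.
  exact: closed_measure1 (@closed_closed_PSh _ _ _ _ _ _ _).
apply/seteqP; split=> mu.
- rewrite ME => Mmu [//|n] _; have [m _ /= mu1] := Mmu n I.
  (* m.+2 and not m.+1: delta must strictly decrease *)
  exists m.+2 => // l l0; apply: (closed_PSh_C_PSh finS _ _ mu1).
    by rewrite ltf_pV2 ?posrE// ltr_nat.
  by rewrite ltrDl invr_gt0 ltr0n.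
- move=> Cmu e e0; have [n] := ltr_add_invr (divr_gt0 e0 (ltr0Sn R 1)).
  rewrite add0r => ne; have [//|m m0 mCmu] := Cmu n.+1.
  exists m%:R^-1; first by rewrite invr_gt0 ltr0n.
  (* l = n.+1 makes both summands 1/n and 1/l smaller than e / 2 *)
  have /C_PSh_meets_Sh := mCmu n.+1 isT; apply: meets_Sh_le => //.
  by rewrite [leRHS]splitr lerD// ltW.
Qed.
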